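(* Let $k\ge 3$ be a fixed integer. Then \[ r(B_n^{(k)}, C_n)= (k+1+o_k(1))\,n, \] where $o_k(1)$ denotes a quantity (depending on $k$ and $n$) that tends to $0$ as $n\to\infty$ with $k$ fixed; that is, $\lim_{n\to\infty} r(B_n^{(k)},C_n)/n = k+1$.
   Context: For graphs $H_1$ and $H_2$, the Ramsey number $r(H_1,H_2)$ is the minimum integer $N$ such that every red-blue edge coloring of the complete graph $K_N$ contains either a red copy of $H_1$ or a blue copy of $H_2$ (as a not necessarily induced subgraph). For positive integers $k,n$, the book graph $B_n^{(k)}$ consists of $n$ copies of $K_{k+1}$ all sharing a common $K_k$ (that is, a clique $K_k$ together with $n$ further, pairwise non-adjacent vertices, each adjacent to all vertices of that $K_k$). $C_n$ denotes the cycle of length $n$. *)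

(* Defs.v *)
From mathcomp Require Import all_boot.

Set Implicit Arguments.
Unset Strict Implicit.
Unset Printing Implicit Defensive.

Record sgraph := SGraph {
  vertex :> finType;
  adj : rel vertex;
  adj_sym : symmetric adj;
  adj_irrefl : irreflexive adj
}.

(* An edge colouring of K_N is represented by a boolean function on subsets of
   the vertex set 'I_N, with [true] for red and [false] for blue. Only its
   values on two-element sets are ever used. *)
Definition edge_coloring (N : nat) := {ffun {set 'I_N} -> bool}.

(* The copy is not required to be induced: [f] is only an injection sending
   edges of [G] to edges of colour [b]. *)
Definition has_copy (G : sgraph) (N : nat) (c : edge_coloring N) (b : bool) :=
  [exists f : {ffun G -> 'I_N},
    injectiveb f &&
    [forall x, forall y, adj x y ==> (c [set f x; f y] == b)]].

Definition arrows (G H : sgraph) (N : nat) : bool :=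
  [forall c : edge_coloring N, has_copy G c true || has_copy H c false].

(* Ramsey's theorem, needed for the minimum below to exist. *)
Definition mono_clique (V : finType) (c : {set V} -> bool) (b : bool)
    (B : {set V}) :=
  forall x y, x \in B -> y \in B -> x != y -> c [set x; y] = b.

Lemma ramsey_cliques (s t : nat) : exists N,
  forall (V : finType) (c : {set V} -> bool) (A : {set V}), N <= #|A| ->
  (exists B : {set V}, [/\ B \subset A, #|B| = s & mono_clique c true B]) \/
  (exists B : {set V}, [/\ B \subset A, #|B| = t & mono_clique c false B]).
Proof.
have [m] := ubnP (s + t); elim: m s t => // m IH [|s] [|t] le_m.
- by exists 0 => V c A _; left; exists set0; split;
    rewrite ?sub0set ?cards0 // => x y; rewrite inE.
- by exists 0 => V c A _; left; exists set0; split;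
    rewrite ?sub0set ?cards0 // => x y; rewrite inE.
- by exists 0 => V c A _; right; exists set0; split;
    rewrite ?sub0set ?cards0 // => x y; rewrite inE.
have [|N1 hN1] := IH s t.+1; first by [].
have [|N2 hN2] := IH s.+1 t; first by rewrite addSnnS.
exists (N1 + N2).+1 => V c A hA.
have [v vA] : exists v, v \in A.
  by apply/set0Pn; rewrite -card_gt0; apply: leq_trans hA.
pose Nb b := [set x in A :\ v | c [set v; x] == b].
have cardN : N1 + N2 <= #|Nb true| + #|Nb false|.
  move: hA; rewrite (cardsD1 v A) vA add1n ltnS => /leq_trans; apply.
  apply: leq_trans (leq_card_setU _ _); apply/subset_leq_card/subsetP => x.
  by rewrite !inE; case: (c [set v; x]); case: (x != v); case: (x \in A).
have ext (b : bool) (B : {set V}) r : B \subset Nb b -> #|B| = r -> mono_clique c b B ->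
  exists B' : {set V}, [/\ B' \subset A, #|B'| = r.+1 & mono_clique c b B'].
  move=> /subsetP BN Br mB.
  have BNP x : x \in B -> [/\ x != v, x \in A & c [set v; x] = b].
    by move/BN; rewrite !inE => /andP[/andP[-> ->] /eqP ->].
  exists (v |: B); split.
  - apply/subsetP => x; rewrite !inE => /orP[/eqP-> //|].
    by case/BNP.
  - rewrite cardsU1 Br; suff -> : v \notin B by [].
    by apply/negP => /BNP[]; rewrite eqxx.
  - move=> x y; rewrite !inE => /orP[/eqP->|xB] /orP[/eqP->|yB].
    + by rewrite eqxx.
    + by case/BNP: yB.
    + by rewrite setUC; case/BNP: xB.
    + exact: mB.
have sub (b : bool) (B : {set V}) : B \subset Nb b -> B \subset A.
  move=> /subsetP BN; apply/subsetP => x /BN.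
  by rewrite !inE => /andP[/andP[]].
case: (leqP N1 #|Nb true|) => [h1|h1].
  case: (hN1 _ c _ h1) => [[B [B1 B2 B3]]|[B [B1 B2 B3]]].
    by left; apply: (ext true B).
  by right; exists B; split => //; apply: sub B1.
have h2 : N2 <= #|Nb false|.
  rewrite -(leq_add2l N1); apply: leq_trans cardN _.
  by rewrite leq_add2r ltnW.
case: (hN2 _ c _ h2) => [[B [B1 B2 B3]]|[B [B1 B2 B3]]].
  by left; exists B; split => //; apply: sub B1.
by right; apply: (ext false B).
Qed.

Lemma mono_clique_copy (G : sgraph) (N : nat) (c : edge_coloring N) (b : bool)
    (B : {set 'I_N}) : #|B| = #|G| -> mono_clique c b B -> has_copy G c b.
Proof.
move=> cB mB.
pose f := [ffun x : G => enum_val (cast_ord (esym cB) (enum_rank x))].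
have f_inj : injective f.
  by move=> x y; rewrite !ffunE => /enum_val_inj/cast_ord_inj/enum_rank_inj.
apply/existsP; exists f; apply/andP; split; first exact/injectiveP.
apply/forallP => x; apply/forallP => y; apply/implyP => xy; apply/eqP/mB.
- by rewrite ffunE enum_valP.
- by rewrite ffunE enum_valP.
- by apply: contraTneq xy => /f_inj ->; rewrite adj_irrefl.
Qed.

Lemma ramsey_exists (G H : sgraph) : exists N, arrows G H N.
Proof.
have [N hN] := ramsey_cliques #|G| #|H|; exists N; apply/forallP => c.
case: (hN _ c setT) => [|[B [_ cB mB]]|[B [_ cB mB]]].
- by rewrite cardsT card_ord.
- by rewrite (mono_clique_copy cB mB).
- by rewrite (mono_clique_copy cB mB) orbT.
Qed.

Definition ramsey (G H : sgraph) : nat := ex_minn (ramsey_exists G H).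

(* The left summand is the common clique K_k, the right one the n pages. *)
Definition book_adj (k n : nat) (x y : 'I_k + 'I_n) : bool :=
  match x, y with
  | inl i, inl j => i != j
  | inr _, inr _ => false
  | _, _ => true
  end.

Lemma book_adj_sym k n : symmetric (@book_adj k n).
Proof. by move=> [i|i] [j|j] //=; rewrite eq_sym. Qed.

Lemma book_adj_irrefl k n : irreflexive (@book_adj k n).
Proof. by move=> [i|i] //=; rewrite eqxx. Qed.

Definition book_graph (k n : nat) : sgraph :=
  SGraph (@book_adj_sym k n) (@book_adj_irrefl k n).

(* [ordS] is the successor modulo n. This is the n-cycle for n >= 3; the
   condition [i != j] only matters for n = 1, where it excludes a loop. *)
Definition cycle_adj (n : nat) (i j : 'I_n) : bool :=
  (i != j) && ((j == ordS i) || (i == ordS j)).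

Lemma cycle_adj_sym n : symmetric (@cycle_adj n).
Proof. by move=> i j; rewrite /cycle_adj eq_sym orbC. Qed.

Lemma cycle_adj_irrefl n : irreflexive (@cycle_adj n).
Proof. by move=> i; rewrite /cycle_adj eqxx. Qed.

Definition cycle_graph (n : nat) : sgraph :=
  SGraph (@cycle_adj_sym n) (@cycle_adj_irrefl n).

(* Main.v *)
Require Import Defs.
From mathcomp Require Import classical_sets reals topology normedtype sequences.
From mathcomp Require Import all_boot all_order all_algebra zify lra.
Import numFieldNormedType.Exports.

(* Lower bound: colour blue the edges inside [k + 1] classes of size [n - 1].

   Upper bound, on [(k + 1) M] vertices with [M = n + E] and [E] about [n / q].
   A vertex of blue degree less than [M] leaves [k M] red neighbours, which
   permits induction on [k]. Otherwise every blue degree is at least [M]. A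
   bounded number of hubs dominates in blue all but at most [E / 2] vertices,
   and a bounded set [S], containing the hubs, connects any two hubs that have
   adjacent neighbours. Off [S] and the undominated vertices, every blue
   neighbourhood still has [n + k] vertices and so contains a blue edge, unless
   there is a red clique on [n + k] vertices, which contains the book. A chain
   of triangles followed by a greedy path then joins two vertices by blue paths
   of all lengths in a long interval; the detour through [S] between their hubs
   closes one of them into a blue cycle with exactly [n] vertices. *)

Section Graphs.
Set Implicit Arguments.
Unset Strict Implicit.
Local Open Scope nat_scope.

Variables (T : finType) (e : rel T).
Hypotheses (e_sym : symmetric e) (e_irr : irreflexive e).

Definition nbr (B : {set T}) v := [set x in B | e v x].
Definition independent (I : {set T}) :=
  [forall x in I, forall y in I, ~~ e x y].
Definition uncovered (A H : {set T}) :=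
  [set u in A | [forall h in H, ~~ e h u]].

Lemma sum_nbr (A U : {set T}) :
  \sum_(h in A) #|nbr U h| = \sum_(u in U) #|nbr A u|.
Proof.
under eq_bigr do rewrite -sum1_card; under [RHS]eq_bigr do rewrite -sum1_card.
rewrite (exchange_big_dep (mem U)) /=; last by move=> i j _; rewrite inE => /andP[].
apply: eq_bigr => u uU; apply: eq_bigl => h.
by rewrite !inE uU /= e_sym.
Qed.

Lemma exists_hub (A U : {set T}) K M :
  {in A, forall v, M <= #|nbr A v|} -> #|A| <= K * M -> U \subset A ->
  0 < #|U| -> exists2 h, h \in A & #|U| <= K * #|nbr U h|.
Proof.
move=> degA cA UA U0; apply/exists_inP; apply/contraT.
rewrite negb_exists_in => /forall_inP H; exfalso.
have A0 : 0 < #|A| by apply: leq_trans U0 (subset_leq_card UA).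
have h1 : \sum_(h in A) (K * #|nbr U h|).+1 <= \sum_(h in A) #|U|.
  by apply: leq_sum => h hA; move: (H h hA); rewrite -ltnNge.
have h2 : \sum_(u in U) M <= \sum_(u in U) #|nbr A u|.
  by apply: leq_sum => u uU; exact: degA _ (subsetP UA _ uU).
have h3 : \sum_(h in A) (K * #|nbr U h|).+1
    = K * \sum_(u in U) #|nbr A u| + #|A|.
  rewrite -sum_nbr big_distrr /= -sum1_card -big_split /=.
  by apply: eq_bigr => i _; rewrite addn1.
rewrite h3 sum_nat_const in h1; rewrite sum_nat_const in h2.
nia.
Qed.

Lemma hub_cover (A : {set T}) K M E t :
  {in A, forall v, M <= #|nbr A v|} -> #|A| <= K * M ->
  exists H : {set T}, #|H| <= t /\
    (2 * #|uncovered A H| <= E \/ t * E <= 2 * K * #|A :\: uncovered A H|).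
Proof.
move=> degA cA; elim: t => [|t [H [cH [small|big]]]].
- by exists set0; rewrite cards0; split=> //; right.
- by exists H; split; [apply: leqW | left].
case: (leqP (2 * #|uncovered A H|) E) => [small|large].
  by exists H; split; [apply: leqW | left].
have UA : uncovered A H \subset A by apply/subsetP => x; rewrite inE => /andP[].
have U0 : 0 < #|uncovered A H| by lia.
have [h hA hU] := exists_hub degA cA UA U0.
exists (h |: H); split; first by rewrite cardsU1; case: (_ \notin _); lia.
right.
have sub : (A :\: uncovered A H) :|: nbr (uncovered A H) h
    \subset A :\: uncovered A (h |: H).
  apply/subsetP => x; rewrite in_setU !in_setD => /orP[/andP[xU xA]|].
    rewrite xA andbT; apply: contra xU; rewrite !inE xA /= => /forall_inP F.
    by apply/forall_inP => y yH; apply: F; rewrite !inE yH orbT.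
  rewrite inE => /andP[xU hx]; rewrite (subsetP UA _ xU) andbT.
  rewrite inE negb_and; apply/orP; right; rewrite negb_forall_in.
  by apply/exists_inP; exists h; rewrite ?negbK // !inE eqxx.
have := subset_leq_card sub; rewrite cardsU.
have -> : (A :\: uncovered A H) :&: nbr (uncovered A H) h = set0.
  by apply/setP => x; rewrite !inE; case: (x \in A) => //=; case: [forall _ in _, _].
rewrite cards0; nia.
Qed.

Definition within (S : {set T}) : rel T :=
  [rel x y | [&& x \in S, y \in S & e x y]].

Lemma within_sym S : symmetric (within S).
Proof. by move=> x y; rewrite /within /= e_sym andbCA. Qed.

(* For each pair of hubs joined by a path of length three, [S] receives the
   inner vertices of one such path. *)
Lemma connector (H : {set T}) : exists S : {set T},
  [/\ H \subset S, #|S| <= #|H| + 2 * #|H| ^ 2 &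
   forall b b' h h', e b b' -> h \in H -> h' \in H -> e h b -> e h' b' ->
     connect (within S) h h'].
Proof.
pose good (q p : T * T) := [&& e q.1 p.1, e p.1 p.2 & e q.2 p.2].
pose f q := if [pick p | good q p] is Some p then [set p.1; p.2] else set0.
exists (H :|: \bigcup_(q in setX H H) f q); split.
- exact: subsetUl.
- apply: leq_trans (leq_card_setU _ _) _; rewrite leq_add2l.
  have -> : 2 * #|H| ^ 2 = \sum_(q in setX H H) 2.
    by rewrite sum_nat_const cardsX mulnC.
  elim/big_rec2: _ => [|q s F _ le_Fs]; first by rewrite cards0.
  apply: leq_trans (leq_card_setU _ _) _; apply: leq_add => //.
  rewrite /f; case: pickP => [p _|_]; last by rewrite cards0.
  by rewrite cards2; case: (_ != _).
move=> b b' h h' bb hH hH' hb hb'.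
set S := _ :|: _.
have [p /and3P[p1 p2 p3] pS] : exists2 p, good (h, h') p & f (h, h') = [set p.1; p.2].
  rewrite /f; case: pickP => [p gp|/(_ (b, b'))]; first by exists p.
  by rewrite /good /= bb hb hb'.
have sS : [set p.1; p.2] \subset S.
  by rewrite -pS subsetU // (bigcup_sup (h, h')) ?orbT // !inE /= hH.
have HS x : x \in H -> x \in S by move=> xH; rewrite inE xH.
have S1 : p.1 \in S by apply: (subsetP sS); rewrite !inE eqxx.
have S2 : p.2 \in S by apply: (subsetP sS); rewrite !inE eqxx orbT.
have step x y : x \in S -> y \in S -> e x y -> connect (within S) x y.
  by move=> xS yS xy; apply: connect1; apply/and3P.
apply: connect_trans (step _ _ (HS _ hH) S1 p1) _.
apply: connect_trans (step _ _ S1 S2 p2) _.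
by apply: step => //; [apply: HS | rewrite e_sym].
Qed.

Lemma nbr_avoid (B Z : {set T}) v : #|nbr B v| - #|Z| <= #|nbr B v :\: Z|.
Proof.
have := cardsID Z (nbr B v); have := subset_leq_card (subsetIr (nbr B v) Z); lia.
Qed.

(* Triangles glued in a chain give paths of all lengths between [t] and [2 t]
   with the same ends; a greedy path of length [j] is appended. *)
Lemma flexible_path (B : {set T}) d s t j w :
  {in B, forall v, d <= #|nbr B v|} ->
  (forall I : {set T}, I \subset B -> independent I -> #|I| < s) ->
  2 * t + 1 + s <= d -> j + 2 * t + 1 <= d -> w \in B ->
  exists v (X : {set T}), [/\ X \subset B, #|X| <= j + 2 * t &
    forall x, x <= t -> exists p, [/\ path e w p, last w p = v,
      uniq (w :: p), {subset p <= X} & size p = j + t + x]].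
Proof.
move=> degB noI; elim: j => [|j IHj] lt lj wB; last first.
  have [|//|v [X [XB cX pX]]] := IHj lt; first by lia.
  have vB : v \in B.
    have [p [_ <- _ sp _]] := pX 0 isT.
    by have := mem_last w p; rewrite inE => /orP[/eqP->|/sp /(subsetP XB)].
  have : 0 < #|nbr B v :\: (w |: X)|.
    apply: leq_trans (nbr_avoid _ _ _); have := degB v vB.
    by rewrite cardsU1; case: (_ \notin _); lia.
  rewrite card_gt0 => /set0Pn[u]; rewrite !inE negb_or => /andP[/andP[uw uX] /andP[uB vu]].
  exists u, (u |: X); split.
  - by rewrite subUset sub1set uB.
  - by rewrite cardsU1 uX; lia.
  move=> x xt; have [p [p1 p2 p3 p4 p5]] := pX x xt.
  exists (rcons p u); split.
  - by rewrite rcons_path p1 p2.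
  - by rewrite last_rcons.
  - rewrite -rcons_cons rcons_uniq p3 andbT inE negb_or uw.
    by apply: contra uX; apply: p4.
  - by move=> y; rewrite mem_rcons !inE => /orP[->//|/p4 ->]; rewrite orbT.
  - by rewrite size_rcons p5.
elim: t lt {lj} => [|t IHt] lt.
  exists w, set0; split; rewrite ?sub0set ?cards0 // => x.
  by rewrite leqn0 => /eqP ->; exists [::].
have [|v [X [XB cX pX]]] := IHt; first by lia.
have vB : v \in B.
  have [p [_ <- _ sp _]] := pX 0 isT.
  by have := mem_last w p; rewrite inE => /orP[/eqP->|/sp /(subsetP XB)].
have sN : nbr B v :\: (w |: X) \subset B.
  by apply/subsetP => u; rewrite !inE => /andP[_ /andP[]].
have cN : s <= #|nbr B v :\: (w |: X)|.
  apply: leq_trans (nbr_avoid _ _ _); have := degB v vB.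
  by rewrite cardsU1; case: (_ \notin _); lia.
have [a [u [aN uN au]]] : exists a u,
    [/\ a \in nbr B v :\: (w |: X), u \in nbr B v :\: (w |: X) & e a u].
  have : ~~ independent (nbr B v :\: (w |: X)).
    by apply/negP => /(noI _ sN); rewrite ltnNge cN.
  rewrite negb_forall_in => /exists_inP[a aN].
  rewrite negb_forall_in => /exists_inP[u uN]; rewrite negbK => au.
  by exists a, u.
move: aN uN; rewrite !inE !negb_or => /andP[/andP[aw aX] /andP[aB va]].
move=> /andP[/andP[uw uX] /andP[uB vu]].
have au' : a != u by apply: contraTneq au => ->; rewrite e_irr.
exists u, (a |: (u |: X)); split.
- by rewrite !subUset !sub1set aB uB.
- have aUX : a \notin u |: X by rewrite !inE negb_or au'.
  by rewrite cardsU1 aUX cardsU1 uX; clear -cX; lia.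
move=> x; rewrite leq_eqVlt ltnS => /predU1P[->|xt]; last first.
  have [p [p1 p2 p3 p4 p5]] := pX x xt.
  exists (rcons p u); split.
  - by rewrite rcons_path p1 p2.
  - by rewrite last_rcons.
  - rewrite -rcons_cons rcons_uniq p3 andbT inE negb_or uw.
    by apply: contra uX; apply: p4.
  - by move=> y; rewrite mem_rcons !inE => /orP[->|/p4 ->]; rewrite !orbT.
  - by rewrite size_rcons p5 !add0n addSn.
have [p [p1 p2 p3 p4 p5]] := pX t (leqnn t).
exists (rcons (rcons p a) u); split.
- by rewrite !rcons_path p1 p2 last_rcons va.
- by rewrite last_rcons.
- rewrite -!rcons_cons !rcons_uniq p3 andbT !(mem_rcons, inE) !negb_or uw aw.
  by rewrite eq_sym au' /= (contra (p4 u) uX) (contra (p4 a) aX).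
- by move=> y; rewrite !(mem_rcons, inE) => /or3P[->|->|/p4 ->]; rewrite ?orbT.
- by rewrite !size_rcons p5 !add0n addSn addnS.
Qed.

Lemma path_connect_hub (B S : {set T}) (g : T -> T) w p :
  (forall b b', b \in B -> b' \in B -> e b b' -> connect (within S) (g b) (g b')) ->
  w \in B -> {subset p <= B} -> path e w p ->
  connect (within S) (g w) (g (last w p)).
Proof.
move=> gP; elim: p w => [|a p IHp] w wB pB //= /andP[wa pa].
have aB : a \in B by apply: pB; rewrite mem_head.
apply: connect_trans (gP _ _ wB aB wa) _.
by apply: IHp => // x xp; apply: pB; rewrite inE xp orbT.
Qed.


Lemma within_path_sub (S : {set T}) x p :
  x \in S -> path (within S) x p -> {subset x :: p <= S}.
Proof.
elim: p x => [|y p IHp] x xS /=; first by move=> _ z; rewrite inE => /eqP->.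
move=> /andP[/and3P[_ yS _] py] z; rewrite inE => /predU1P[->//|].
exact: IHp.
Qed.

Lemma cycle_through_connector (B S : {set T}) (g : T -> T) d s t n w :
  {in B, forall v, d <= #|nbr B v|} ->
  (forall I : {set T}, I \subset B -> independent I -> #|I| < s) ->
  2 * t + 1 + s <= d -> n <= d -> 2 * t + 1 <= n -> w \in B ->
  #|S| <= t -> [disjoint B & S] ->
  (forall b, b \in B -> g b \in S /\ e b (g b)) ->
  (forall b b', b \in B -> b' \in B -> e b b' ->
    connect (within S) (g b) (g b')) ->
  exists2 c, ucycle e c & size c = n.
Proof.
move=> degB noI ltd nd tn wB cS dBS gB gS.
have ljd : (n - (2 * t + 1)) + 2 * t + 1 <= d by lia.
have [v [X [XB _ pX]]] := flexible_path degB noI ltd ljd wB.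
have vB : v \in B.
  have [p [_ <- _ sp _]] := pX 0 isT.
  by have := mem_last w p; rewrite inE => /orP[/eqP->|/sp /(subsetP XB)].
have : connect (within S) (g v) (g w).
  have [p [p1 p2 _ sp _]] := pX 0 isT.
  rewrite (sym_connect_sym (@within_sym S)).
  rewrite -p2; apply: (path_connect_hub gS) => // x /sp.
  exact: subsetP.
move=> /connectP[q0 /shortenP[q pq uq _] lq] {q0}.
have [gvS egv] := gB _ vB; have [gwS egw] := gB _ wB.
have qS := within_path_sub gvS pq.
have cq : size (g v :: q) <= t.
  apply: leq_trans cS; rewrite -(card_uniqP uq); apply/subset_leq_card/subsetP.
  exact: qS.
have [p [p1 p2 p3 p4 p5]] := pX (t - size (g v :: q)) (leq_subr _ _).
exists (w :: p ++ g v :: q).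
  apply/andP; split.
    rewrite /= rcons_cat cat_path p1 p2 /= egv rcons_path -lq e_sym egw andbT.
    by apply: sub_path pq => x y /and3P[].
  rewrite -cat_cons cat_uniq p3 uq andbT andTb.
  apply/hasPn => x /qS xS; apply: contraL xS => xp.
  apply: negbT; apply: (disjointFr dBS); move: xp; rewrite inE => /predU1P[->//|/p4].
  exact: subsetP.
by rewrite /= size_cat p5; clear -cq tn; move: cq => /=; lia.
Qed.

Definition hubs K q := 2 * K ^ 2 * q.+1 + 1.
Definition connector_size K q := hubs K q + 2 * hubs K q ^ 2.

Lemma dense_cycle (A : {set T}) K q k n E :
  0 < q -> n <= q * E -> 2 * connector_size K q < n ->
  2 * (3 * connector_size K q + k + 2) <= E ->
  {in A, forall v, n + E <= #|nbr A v|} -> #|A| <= K * (n + E) -> A != set0 ->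
  (exists2 c, ucycle e c & size c = n) \/
  (exists I : {set T}, [/\ I \subset A, independent I & n + k <= #|I|]).
Proof.
set t := connector_size K q => q0 nqE En tE degA cA A0.
case: (boolP [exists I : {set T}, [&& I \subset A, independent I & n + k <= #|I|]]).
  by move=> /existsP[I /and3P[]]; right; exists I.
rewrite negb_exists => /forallP noI; left.
have [H [cH covH]] := hub_cover E (hubs K q) degA cA.
have {covH} cU : 2 * #|uncovered A H| <= E.
  case: covH => //; rewrite {1}/hubs => cov.
  have := subset_leq_card (subsetDl A (uncovered A H)).
  have : 0 < E by lia.
  nia.
have [S [HS cS conS]] := connector H.
have {}cS : #|S| <= t.
  apply: leq_trans cS _; rewrite /t /connector_size.
  by apply: leq_add => //; rewrite leq_mul2l leq_sqr.
pose B := A :\: (S :|: uncovered A H).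
have cZ : #|S :|: uncovered A H| <= t + E %/ 2.
  apply: leq_trans (leq_card_setU _ _) _; apply: leq_add => //.
  by rewrite leq_divRL // mulnC.
have BA : B \subset A by apply: subsetDl.
pose d := n + E - (t + E %/ 2).
have degB : {in B, forall v, d <= #|nbr B v|}.
  move=> v vB; apply: leq_trans (leq_sub2l _ cZ) _.
  apply: leq_trans (leq_sub2r _ (degA _ (subsetP BA _ vB))) _.
  apply: leq_trans (nbr_avoid _ _ _) _; apply: subset_leq_card.
  by apply/subsetP => x; rewrite !inE => /and3P[-> -> ->].
have [w wB] : exists w, w \in B.
  apply/set0Pn; rewrite -card_gt0; have [a aA] := set0Pn _ A0.
  have h1 := degA _ aA.
  have h2 : #|nbr A a| <= #|A|.
    by apply/subset_leq_card/subsetP => x; rewrite inE => /andP[].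
  have := cardsID (S :|: uncovered A H) A.
  have := subset_leq_card (subsetIr A (S :|: uncovered A H)).
  rewrite -/B; have := leq_divM E 2; clear -h1 h2 cZ tE; lia.
pose g b := odflt b [pick h in H | e h b].
have gP b : b \in B -> g b \in H /\ e (g b) b.
  rewrite !inE negb_or /g => /andP[/andP[_ bU] bA].
  case: pickP => [h /andP[]//|none]; case/negP: bU; rewrite bA.
  by apply/forall_inP => h hH; have := none h; rewrite hH /= => ->.
apply: (@cycle_through_connector B S g d (n + k) t n w) => //.
- move=> I IB iI; have := noI I; rewrite iI (subset_trans IB BA) /=.
  by rewrite -ltnNge.
- have := leq_divM E 2; rewrite /d; clear -tE; lia.
- have := leq_divM E 2; rewrite /d; clear -tE; lia.
- clear -En; rewrite /t; lia.
- rewrite disjoint_sym disjoint_subset; apply/subsetP => x xS.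
  by rewrite !inE xS.
- by move=> b /gP[gH gb]; split; [apply: (subsetP HS) | rewrite e_sym].
- by move=> b b' /gP[h1 h2] /gP[h3 h4] bb; apply: conS bb h1 h3 h2 h4.
Qed.

(* [P] is the spine of a book in the complement, [D] its set of pages. *)
Definition co_book (A P D : {set T}) :=
  [/\ P \subset A, independent P, [disjoint P & D] &
      {in P & D, forall x y, ~~ e x y}].

Lemma exists_subset (A : {set T}) m :
  m <= #|A| -> exists2 B : {set T}, B \subset A & #|B| = m.
Proof.
move=> /card_geqP[s [us <- sA]]; exists [set x in s].
  by apply/subsetP => x; rewrite inE; apply: sA.
by rewrite cardsE; apply/card_uniqP.
Qed.

Lemma independent_co_book (A I : {set T}) k n :
  I \subset A -> independent I -> n + k <= #|I| ->
  exists P D, [/\ co_book A P D, D \subset A, #|P| = k & #|D| = n].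
Proof.
move=> IA iI cI.
have [|P PI cP] := @exists_subset I k; first by apply: leq_trans cI; apply: leq_addl.
have [|D] := @exists_subset (I :\: P) n.
  by rewrite cardsD (setIidPr PI) cP leq_subRL ?(leq_trans (leq_addl n k)) // addnC.
rewrite subsetD => /andP[DI dDP] cD.
have iIP x y : x \in I -> y \in I -> ~~ e x y.
  by move=> xI yI; have /forall_inP := forall_inP iI x xI; apply.
exists P, D; split=> //; last exact: subset_trans IA.
split; first exact: subset_trans IA.
- apply/forall_inP => x xP; apply/forall_inP => y yP.
  by apply: iIP; apply: (subsetP PI).
- by rewrite disjoint_sym.
- by move=> x y xP yD; apply: iIP; [apply: (subsetP PI) | apply: (subsetP DI)].
Qed.

Lemma cycle_or_co_book q K n : 0 < q ->
  2 * (3 * connector_size K q + K + 2) * q <= n ->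
  forall k (A : {set T}), k < K -> k.+1 * (n + (n %/ q).+1) <= #|A| ->
  (exists2 c, ucycle e c & size c = n) \/
  (exists P D : {set T}, [/\ co_book A P D, D \subset A, #|P| = k & #|D| = n]).
Proof.
move=> q0 hn; set E := (n %/ q).+1.
have nqE : n <= q * E by rewrite mulnC ltnW // ltn_ceil.
have tE : 2 * (3 * connector_size K q + K + 2) <= n %/ q by rewrite leq_divRL.
have tn : 2 * connector_size K q < n.
  by apply: leq_trans (leq_trans tE (leq_div n q)); clear; lia.
elim=> [|k IHk] A kK cA.
  right; have [|D DA cD] := @exists_subset A n.
    by apply: leq_trans cA; rewrite mul1n leq_addr.
  exists set0, D; rewrite cards0; split=> //; split.
  - exact: sub0set.
  - by apply/forall_inP => x; rewrite inE.
  - by rewrite -setI_eq0 set0I.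
  - by move=> x y; rewrite inE.
have [A' A'A cA'] := exists_subset cA.
case: (boolP [exists v in A', #|nbr A' v| < n + E]) => [/exists_inP[v vA' low]|].
  have sub : v |: nbr A' v \subset A'.
    by rewrite subUset sub1set vA'; apply/subsetP => x; rewrite inE => /andP[].
  have [||cyc|[P [D [[PA iP dPD PD] DA cP cD]]]] := IHk (A' :\: (v |: nbr A' v)).
  - exact: ltnW.
  - rewrite cardsD (setIidPr sub) cA' leq_subRL; last first.
      by rewrite -cA'; apply: subset_leq_card.
    rewrite mulSn leq_add2r cardsU1; apply: leq_trans low.
    by case: (_ \notin _).
  - by left.
  right; exists (v |: P), D.
  have nv x : x \in A' :\: (v |: nbr A' v) -> [/\ x != v, x \in A' & ~~ e v x].
    by rewrite !inE negb_or => /andP[/andP[xv]] /[swap] xA'; rewrite xA'.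
  have AA : A' :\: (v |: nbr A' v) \subset A by apply: subset_trans (subsetDl _ _) A'A.
  have NP x : x \in P -> [/\ x != v, x \in A' & ~~ e v x] by move/(subsetP PA)/nv.
  have ND x : x \in D -> [/\ x != v, x \in A' & ~~ e v x] by move/(subsetP DA)/nv.
  split=> //; first split.
  - by rewrite subUset sub1set (subsetP A'A) //= (subset_trans PA).
  - have iPP x y : x \in P -> y \in P -> ~~ e x y.
      by move=> xP yP; have /forall_inP := forall_inP iP x xP; apply.
    apply/forall_inP => x; rewrite !inE => /predU1P[->|xP];
      apply/forall_inP => y; rewrite !inE => /predU1P[->|yP].
    + by rewrite e_irr.
    + by case: (NP y yP).
    + by rewrite e_sym; case: (NP x xP).
    + exact: iPP.
  - rewrite disjoint_subset; apply/subsetP => x; rewrite !inE.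
    move=> /predU1P[->|xP]; last by rewrite (disjointFr dPD xP).
    by apply/negP => /ND[]; rewrite eqxx.
  - move=> x y; rewrite !inE => /predU1P[->|xP] yD; last exact: PD.
    by case: (ND y yD).
  - exact: subset_trans AA.
  - rewrite cardsU1 cP; suff -> : v \notin P by [].
    by apply/negP => /NP[]; rewrite eqxx.
rewrite negb_exists_in => /forall_inP high.
have [||||cyc|[I [IA' iI cI]]] := @dense_cycle A' K q k.+1 n E q0 nqE tn.
- apply: leq_trans (leq_trans tE (leqnSn _)).
  by rewrite leq_mul2l leq_add2r leq_add2l ltnW.
- by move=> v vA'; rewrite leqNgt; apply: high.
- by rewrite cA' leq_mul2r kK orbT.
- by rewrite -card_gt0 cA' muln_gt0 /= addnS.
- by left.
right; apply: independent_co_book (subset_trans IA' A'A) iI cI.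
Qed.

End Graphs.

Lemma cycle_graph_cls (C : eqType) n (f : 'I_n -> C) :
  (forall x y : cycle_graph n, adj x y -> f x = f y) -> forall x y, f x = f y.
Proof.
move=> fE.
have f0 (i0 : 'I_n) : val i0 = 0 -> forall m (hm : m < n), f (Ordinal hm) = f i0.
  move=> i00; elim=> [|m IHm] hm; first by congr f; apply: val_inj.
  rewrite -(IHm (ltnW hm)); apply/esym/fE.
  rewrite /= /cycle_adj -val_eqE /= neq_ltn ltnSn /= -!val_eqE /= modn_small //.
  by rewrite eqxx.
move=> x y; have n0 : 0 < n by apply: leq_ltn_trans (ltn_ord x).
have fx z : f z = f (Ordinal n0) by rewrite -(f0 (Ordinal n0) erefl z (ltn_ord z)); congr f; apply: val_inj.
by rewrite fx [RHS]fx.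
Qed.

Definition partite_coloring (d N : nat) : edge_coloring N :=
  [ffun E : {set 'I_N} => ~~ [forall x in E, forall y in E, x %/ d == y %/ d]].

Lemma partite_coloringE d N (x y : 'I_N) :
  partite_coloring d N [set x; y] = (x %/ d != y %/ d).
Proof.
rewrite ffunE; congr (~~ _); apply/forall_inP/idP => [H|/eqP xy a].
  have /forall_inP := H x (set21 x y); apply; exact: set22.
rewrite !inE => /orP[]/eqP->; apply/forall_inP => b;
  by rewrite !inE => /orP[]/eqP->; rewrite ?xy.
Qed.

Lemma part_size d N n (g : 'I_n -> 'I_N) :
  0 < d -> injective g -> (forall x y, g x %/ d = g y %/ d) -> n <= d.
Proof.
move=> d0 gI gE; pose h x := Ordinal (ltn_pmod (g x) d0).
have hI : injective h.
  move=> x y /(congr1 val) /= xy; apply/gI/val_inj.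
  by rewrite /= (divn_eq (g x) d) (divn_eq (g y) d) xy (gE x y).
by have := leq_card h hI; rewrite !card_ord.
Qed.

Lemma not_arrows_book_cycle k n N :
  1 < n -> N <= k.+1 * n.-1 -> ~~ arrows (book_graph k n) (cycle_graph n) N.
Proof.
move=> n1 hN; apply/negP => /forallP /(_ (partite_coloring n.-1 N)).
have d0 : 0 < n.-1 by rewrite -subn1 subn_gt0.
have nn : n <= n.-1 -> False by case: (n) n1 => // m _; rewrite ltnn.
case/orP => /existsP[f /andP[/injectiveP fI /forallP fE]]; last first.
  apply/nn/(@part_size _ N n f d0 fI); apply: cycle_graph_cls => x y xy.
  by have /forallP/(_ y)/implyP/(_ xy) := fE x; rewrite partite_coloringE eqbF_neg negbK => /eqP.
pose cls (v : 'I_N) := v %/ n.-1.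
have clsE x y : @adj (book_graph k n) x y -> cls (f x) != cls (f y).
  by move=> xy; have /forallP/(_ y)/implyP/(_ xy) := fE x; rewrite partite_coloringE eqb_id.
have cls_lt v : cls v < k.+1 by rewrite /cls ltn_divLR // (leq_trans (ltn_ord v)).
pose c v := Ordinal (cls_lt v).
pose P := [set c (f (inl i)) | i : 'I_k].
have cP : #|P| = k.
  rewrite card_imset ?card_ord // => i j /(congr1 val) /= ij.
  by apply/eqP; apply: contraT => nij; have := clsE (inl i) (inl j) nij; rewrite ij eqxx.
have : #|~: P| = 1 by have := cardsC P; rewrite cP card_ord; lia.
move=> /eqP/cards1P[a Pa].
apply/nn/(@part_size _ N n (fun x => f (inr x)) d0) => [x y /fI[]//|].
have fa x : c (f (inr x)) = a.
  apply/set1P; rewrite -Pa inE; apply/imsetP => -[i _ ci].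
  by have /= cix := congr1 val ci; have := clsE (inr x) (inl i) isT; rewrite cix eqxx.
by move=> x y; have /(congr1 val) := fa x; have /(congr1 val) /= <- := fa y.
Qed.

Lemma arrows_book_cycle q k n : 0 < q -> 2 < n ->
  2 * (3 * connector_size k.+1 q + k.+1 + 2) * q <= n ->
  arrows (book_graph k n) (cycle_graph n) (k.+1 * (n + (n %/ q).+1)).
Proof.
move=> q0 n2 hn; set N := k.+1 * _; apply/forallP => c.
pose e (x y : 'I_N) := (x != y) && ~~ c [set x; y].
have e_sym : symmetric e by move=> x y; rewrite /e eq_sym setUC.
have e_irr : irreflexive e by move=> x; rewrite /e eqxx.
have cT : N <= #|[set: 'I_N]| by rewrite cardsT card_ord.
have [[s us ss]|[P [D [[_ iP dPD PD] _ cP cD]]]] :=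
    cycle_or_co_book e_sym e_irr q0 hn (ltnSn k) cT.
  apply/orP; right; apply/existsP.
  have n0 : 0 < n by apply: ltn_trans n2.
  have x0 : 'I_N by case: (s) ss => [s0|//]; rewrite -s0 in n0.
  have [cs us'] := andP us.
  exists [ffun i : cycle_graph n => nth x0 s (i : 'I_n)]; apply/andP; split.
    apply/injectiveP => i j; rewrite !ffunE => /eqP.
    by rewrite nth_uniq ?ss // => /eqP/val_inj.
  have stepS (i : 'I_n) : e (nth x0 s i) (nth x0 s (ordS i)).
    have is_ : nth x0 s i \in s by rewrite mem_nth ?ss.
    have := next_cycle cs is_; rewrite next_nth is_.
    case: s us ss cs us' is_ => [|y p] _ sp _ up _; first by rewrite -sp in n0.
    rewrite index_uniq ?sp //; congr e; rewrite /=.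
    have [lt|ge] := ltnP i.+1 n.
      rewrite modn_small //=; apply: set_nth_default.
      by rewrite -ltnS -[(size p).+1]/(size (y :: p)) sp.
    have -> : i.+1 = n by apply/eqP; rewrite eqn_leq ge ltn_ord.
    rewrite modnn /= nth_default //.
    by rewrite -ltnS -[(size p).+1]/(size (y :: p)) sp.
  apply/forallP => i; apply/forallP => j; apply/implyP.
  rewrite !ffunE => /andP[_ /orP[]/eqP ->].
    by have /andP[_ /negbTE->] := stepS i.
  by rewrite setUC; have /andP[_ /negbTE->] := stepS j.
apply/orP; left; apply/existsP.
pose f (x : 'I_k + 'I_n) := match x with
  | inl i => enum_val (cast_ord (esym cP) i)
  | inr i => enum_val (cast_ord (esym cD) i) end.
have fP i : f (inl i) \in P by apply: enum_valP.
have fD i : f (inr i) \in D by apply: enum_valP.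
have fI : injective f.
  move=> [i|i] [j|j] fij.
  - by congr inl; apply: (cast_ord_inj (eq_n := esym cP)); apply: enum_val_inj.
  - by have := disjointFr dPD (fP i); rewrite fij fD.
  - by have := disjointFr dPD (fP j); rewrite -fij fD.
  - by congr inr; apply: (cast_ord_inj (eq_n := esym cD)); apply: enum_val_inj.
exists [ffun x : book_graph k n => f x]; apply/andP; split.
  by apply/injectiveP => x y; rewrite !ffunE; apply: fI.
apply/forallP => x; apply/forallP => y; apply/implyP; rewrite !ffunE => xy.
have nxy : f x != f y by apply: contraTneq xy => /fI ->; rewrite adj_irrefl.
suff : ~~ e (f x) (f y) by rewrite /e nxy /= negbK => ->.
case: x y xy {nxy} => [i|i] [j|j] xy //.
- by have /forall_inP := forall_inP iP _ (fP i); apply.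
- exact: PD.
- by rewrite e_sym; apply: PD.
Qed.

Lemma ramsey_book_cycle_gt k n :
  1 < n -> k.+1 * n.-1 < ramsey (book_graph k n) (cycle_graph n).
Proof.
move=> n1; rewrite /ramsey; case: ex_minnP => N aN _; rewrite ltnNge.
by apply: contraL aN; apply: not_arrows_book_cycle.
Qed.

Lemma ramsey_book_cycle_le q k n : 0 < q -> 2 < n ->
  2 * (3 * connector_size k.+1 q + k.+1 + 2) * q <= n ->
  ramsey (book_graph k n) (cycle_graph n) <= k.+1 * (n + (n %/ q).+1).
Proof.
move=> q0 n2 hn; rewrite /ramsey; case: ex_minnP => N _; apply.
exact: arrows_book_cycle.
Qed.

Local Open Scope classical_set_scope.
Local Open Scope ring_scope.
Import Order.TTheory GRing.Theory Num.Theory.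

Theorem theorem2 (R : realType) (k : nat) (hk : (3 <= k)%N) :
  (fun n : nat => (ramsey (book_graph k n) (cycle_graph n))%:R / n%:R : R)
    @ \oo --> ((k%:R + 1) : R).
Proof.
apply/cvgrPdist_le => eps eps0.
(* Both error terms, [(k + 1) / q] and [(k + 1) / n], are to be at most
   [eps / 2]. *)
have [q q0 hq] : exists2 q, (0 < q)%N & 2 * k.+1%:R <= eps * q%:R.
  exists (Num.truncn (2 * k.+1%:R / eps)).+1 => //.
  by rewrite -ler_pdivrMl // mulrC ltW // truncnS_gt.
pose n0 := (2 * (3 * connector_size k.+1 q + k.+1 + 2) * q + q + 3)%N.
near=> n.
have hn : (n0 <= n)%N by near: n; exact: nbhs_infty_ge.
have n3 : (2 < n)%N by apply: leq_trans hn; rewrite /n0; lia.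
have lo := @ramsey_book_cycle_gt k n (ltnW n3).
have qn : (q <= n)%N by apply: leq_trans hn; rewrite /n0; lia.
have := @ramsey_book_cycle_le q k n q0 n3 _.
move=> /(_ (leq_trans (leq_addr _ _) (leq_trans (leq_addr _ _) hn))) up.
set r := ramsey _ _ in lo up *.
have lo' : (k.+1%:R * n%:R <= r%:R + k.+1%:R :> R).
  by rewrite -natrM -natrD ler_nat; move: lo; case: (n) n3 => //= m _; lia.
have up' : (q%:R * r%:R <= k.+1%:R * (q%:R * n%:R + 2 * n%:R) :> R).
  rewrite -!natrM -natrD -natrM ler_nat; apply: leq_trans (leq_mul (leqnn q) up) _.
  rewrite mulnCA leq_mul2l mulnDr leq_add2l mulnS mul2n -addnn leq_add //.
  by rewrite mulnC leq_divM.
have nR : (0 < n%:R :> R) by rewrite ltr0n; lia.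
have qR : (0 < q%:R :> R) by rewrite ltr0n.
have qnR : (q%:R <= n%:R :> R) by rewrite ler_nat.
have KR : (0 < k.+1%:R :> R) by rewrite ltr0n.
rewrite natr1 -[X in X - _](mulfK (lt0r_neq0 nR)) -mulrBl normrM normfV.
rewrite (gtr0_norm nR) ler_pdivrMr // ler_norml; apply/andP; split.
- rewrite -(ler_pM2l qR); nra.
- nra.
Unshelve. all: by end_near.
Qed.
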